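(* Let $R$ be a Hermite ring which has the $D$-property. Then $R$ has the $EDK$-property if and only if each $A\in R^{2\times 2}$ is equivalent to a matrix $\mathrm{diag}(\varepsilon,a)\in R^{2\times 2}$ with $\varepsilon,a\in R$ such that either $RaR\subseteq\varepsilon R=R\varepsilon$ or $\varepsilon=0$.
   Context: Rings are associative (not necessarily commutative) with $1\neq 0$. $R^{n\times m}$ denotes the $n\times m$ matrices over $R$; $\mathrm{diag}(d_1,\ldots,d_s)$ denotes a possibly rectangular $n\times m$ matrix, $s=\min(n,m)$, with $d_1,\ldots,d_s$ on the main diagonal and zeros elsewhere. Matrices $A,B$ are equivalent if $A=PBQ$ for some invertible square matrices $P,Q$ over $R$ of suitable sizes. $R$ is a Hermite ring if for all $a,b\in R$ there are $P,Q\in \mathrm{GL}_2(R)$ and $c,d\in R$ with $(a,b)P=(c,0)$ and $Q(a,b)^T=(d,0)^T$. $R$ has the $D$-property if for each $a\in R$ there is $a_*\in R$ with $RaR=a_*R=Ra_*$. A nonzero element $a\in R$ is duo if $aR$ and $Ra$ are two-sided ideals and $aR=Ra$. $R$ has the $EDK$-property if for each (possibly rectangular) matrix $A$ over $R$ there are invertible matrices $P,Q$ of suitable sizes such that $PAQ=\mathrm{diag}(\varepsilon_1,\ldots,\varepsilon_k,0,\ldots,0)$, where $R\varepsilon_{i+1}R\subseteq R\varepsilon_i\cap\varepsilon_iR$ for all $i=1,\ldots,k-1$ and $\varepsilon_1,\ldots,\varepsilon_{k-1}$ are duo elements of $R$. *)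

(* Defs.v *)
From HB Require Import structures.
From mathcomp Require Import all_boot all_order all_algebra.
From mathcomp Require Import boolp classical_sets.

Set Implicit Arguments.
Unset Strict Implicit.
Unset Printing Implicit Defensive.

Import GRing.Theory.
Local Open Scope ring_scope.
Local Open Scope classical_set_scope.

Section Ideals.
Variable R : nzRingType.
Implicit Types (a : R) (I : set R).

(* aR *)
Definition principal_right a : set R := [set a * r | r in [set: R]].

(* Ra *)
Definition principal_left a : set R := [set r * a | r in [set: R]].

(* RaR: as R is noncommutative, finite sums of products x * a * y are needed *)
Definition principal_two_sided a : set R :=
  [set \sum_(p <- s) p.1 * a * p.2 | s in [set: seq (R * R)]].

Definition two_sided_ideal I : Prop :=
  [/\ I 0,
      forall x y, I x -> I y -> I (x - y),
      forall r x, I x -> I (r * x) &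
      forall r x, I x -> I (x * r)].

Definition duo a : Prop :=
  [/\ a <> 0,
      two_sided_ideal (principal_right a),
      two_sided_ideal (principal_left a) &
      principal_right a = principal_left a].

End Ideals.

Section Matrices.
Variable R : nzRingType.

(* [unitmx] is available only over commutative rings *)
Definition mx_invertible n (P : 'M[R]_n) : Prop :=
  exists P' : 'M[R]_n, P *m P' = 1%:M /\ P' *m P = 1%:M.

Definition mx_equivalent m n (A B : 'M[R]_(m, n)) : Prop :=
  exists (P : 'M[R]_m) (Q : 'M[R]_n),
    [/\ mx_invertible P, mx_invertible Q & A = P *m B *m Q].

(* diag(d_1, ..., d_k, 0, ..., 0), rectangular; meant for k <= minn m n, as
   further entries of [d] would be ignored *)
Definition rect_diag m n (d : seq R) : 'M[R]_(m, n) :=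
  \matrix_(i < m, j < n) (if i == j :> nat then d`_i else 0).

Definition row2 (a b : R) : 'rV[R]_2 := \row_(j < 2) [:: a; b]`_j.

End Matrices.

Definition hermite_ring (R : nzRingType) : Prop :=
  forall a b : R, exists (P Q : 'M[R]_2) (c d : R),
    [/\ mx_invertible P, mx_invertible Q,
        row2 a b *m P = row2 c 0 &
        Q *m (row2 a b)^T = (row2 d 0)^T].

Definition D_property (R : nzRingType) : Prop :=
  forall a : R, exists a' : R,
    principal_two_sided a = principal_right a' /\
    principal_right a' = principal_left a'.

(* Indices are shifted: [eps`_i] is epsilon_(i+1). The last element of [eps]
   is not required to be duo, nor to be nonzero. *)
Definition EDK_property (R : nzRingType) : Prop :=
  forall (m n : nat) (A : 'M[R]_(m, n)),
    exists (P : 'M[R]_m) (Q : 'M[R]_n) (eps : seq R),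
      [/\ mx_invertible P, mx_invertible Q,
          (size eps <= minn m n)%N,
          P *m A *m Q = rect_diag m n eps &
          forall i : nat, (i.+1 < size eps)%N ->
            principal_two_sided eps`_i.+1 `<=`
              principal_left eps`_i `&` principal_right eps`_i
            /\ duo eps`_i].

(* Main.v *)
Require Import Defs.
From HB Require Import structures.
From mathcomp Require Import all_boot all_order all_algebra all_fingroup.
From mathcomp Require Import boolp classical_sets.

Set Implicit Arguments.
Unset Strict Implicit.
Unset Printing Implicit Defensive.

Import GRing.Theory.
Local Open Scope ring_scope.
Local Open Scope classical_set_scope.

(** The substance is that normal forms of 2 x 2 matrices, together with the
    Hermite property, give normal forms of all matrices. The proof is by
    induction on the number of rows. Single rows and single columns are
    handled by the Hermite property alone ([row_reduction], [col_reduction]).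

    Let A have at least two rows and two columns. The induction hypothesis
    brings the rows below the top one to the form diag(b_1, b_2, ...) with
    each b_{i+1} in b_i R and in R b_i, and the Hermite property then clears
    the top row beyond its first two entries, so that A becomes

<<
        B  0          a    c
        C  D     B =  b_1  0
>>

    where every two-sided ideal containing the entries of B, hence b_1,
    contains all entries of C and D ([reduce_to_2x2_block]). Now replace B by
    its normal form diag(e, a).
    - If e = 0, then the top row is zero and can be moved to the bottom; the
      other rows are covered by the induction hypothesis
      ([has_EDK_form_row0]).
    - Otherwise eR = Re is a two-sided ideal containing the entries of B, so
      it contains all entries of the matrix. The first column is cleared by
      left multiples of e, which leaves diag(e, N) with the entries of N in
      eR. A normal form of N, given by the induction hypothesis, still has
      its entries in eR, so that e can be put in front of it
      ([has_EDK_form_step]).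

    Conversely, the normal form of a 2 x 2 matrix granted by the EDK property
    is already as required if it has two entries; a single entry d need not be
    duo, but diag(d, 0) is equivalent to diag(0, d). *)

(** * Invertible matrices and equivalence *)

Lemma mx_invertible1 (R : nzRingType) n : mx_invertible (1%:M : 'M[R]_n).
Proof. by exists 1%:M; rewrite mulmx1. Qed.

Lemma mx_invertibleM (R : nzRingType) n (P Q : 'M[R]_n) :
  mx_invertible P -> mx_invertible Q -> mx_invertible (P *m Q).
Proof.
move=> [P' [PP' P'P]] [Q' [QQ' Q'Q]]; exists (Q' *m P'); split.
  by rewrite mulmxA -(mulmxA P) QQ' mulmx1.
by rewrite mulmxA -(mulmxA Q') P'P mulmx1.
Qed.

Lemma mx_invertible_diag (R : nzRingType) m n (P : 'M[R]_m) (Q : 'M[R]_n) :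
  mx_invertible P -> mx_invertible Q -> mx_invertible (block_mx P 0 0 Q).
Proof.
move=> [P' [PP' P'P]] [Q' [QQ' Q'Q]]; exists (block_mx P' 0 0 Q').
by rewrite !mulmx_block !mul0mx !mulmx0 !addr0 !add0r PP' P'P QQ' Q'Q
  -scalar_mx_block.
Qed.

Lemma mx_invertible_lower (R : nzRingType) m n (X : 'M[R]_(n, m)) :
  mx_invertible (block_mx 1%:M 0 X 1%:M).
Proof.
exists (block_mx 1%:M 0 (- X) 1%:M).
rewrite !mulmx_block !mul0mx !mulmx0 !mulmx1 !mul1mx !addr0 !add0r.
by rewrite subrr addNr -scalar_mx_block.
Qed.

Lemma mx_invertible_perm (R : nzRingType) n (s : 'S_n) :
  mx_invertible (perm_mx s : 'M[R]_n).
Proof.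
exists (perm_mx s^-1%g).
by rewrite -!perm_mxM mulgV mulVg perm_mx1.
Qed.

Lemma mx_equivalent_refl (R : nzRingType) m n (A : 'M[R]_(m, n)) :
  mx_equivalent A A.
Proof.
exists 1%:M, 1%:M.
by split; rewrite ?mulmx1 ?mul1mx //; apply: mx_invertible1.
Qed.

Lemma mx_equivalent_sym (R : nzRingType) m n (A B : 'M[R]_(m, n)) :
  mx_equivalent A B -> mx_equivalent B A.
Proof.
move=> [P [Q [[P' [PP' P'P]] [Q' [QQ' Q'Q]] ->]]].
exists P', Q'; split; [by exists P | by exists Q |].
by rewrite !mulmxA P'P mul1mx -mulmxA QQ' mulmx1.
Qed.

Lemma mx_equivalent_trans (R : nzRingType) m n (B A C : 'M[R]_(m, n)) :
  mx_equivalent A B -> mx_equivalent B C -> mx_equivalent A C.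
Proof.
move=> [P [Q [iP iQ ->]]] [P1 [Q1 [iP1 iQ1 ->]]].
exists (P *m P1), (Q1 *m Q).
by split; [exact: mx_invertibleM.. | rewrite !mulmxA].
Qed.

Lemma mx_equivalentMl (R : nzRingType) m n (P : 'M[R]_m) (A : 'M[R]_(m, n)) :
  mx_invertible P -> mx_equivalent (P *m A) A.
Proof.
by move=> iP; exists P, 1%:M; split => //;
  [exact: mx_invertible1 | rewrite mulmx1].
Qed.

Lemma mx_equivalentMr (R : nzRingType) m n (A : 'M[R]_(m, n)) (Q : 'M[R]_n) :
  mx_invertible Q -> mx_equivalent (A *m Q) A.
Proof.
by move=> iQ; exists 1%:M, Q; split => //;
  [exact: mx_invertible1 | rewrite mul1mx].
Qed.

Lemma mx_equivalent_row_perm (R : nzRingType) m n (s : 'S_m)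
    (A : 'M[R]_(m, n)) :
  mx_equivalent (row_perm s A) A.
Proof. by rewrite row_permE; apply/mx_equivalentMl/mx_invertible_perm. Qed.

Lemma mx_equivalent_col_perm (R : nzRingType) m n (s : 'S_n)
    (A : 'M[R]_(m, n)) :
  mx_equivalent (col_perm s A) A.
Proof. by rewrite col_permE; apply/mx_equivalentMr/mx_invertible_perm. Qed.

Lemma mx_equivalent_block_diag (R : nzRingType) m1 m2 n1 n2
    (A : 'M[R]_(m1, n1)) (B C : 'M[R]_(m2, n2)) :
  mx_equivalent B C -> mx_equivalent (block_mx A 0 0 B) (block_mx A 0 0 C).
Proof.
move=> [P [Q [iP iQ ->]]].
exists (block_mx 1%:M 0 0 P), (block_mx 1%:M 0 0 Q).
split.
- exact: mx_invertible_diag (mx_invertible1 _ _) iP.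
- exact: mx_invertible_diag (mx_invertible1 _ _) iQ.
- by rewrite !mulmx_block !(mul0mx, mulmx0, addr0, add0r) mul1mx mulmx1.
Qed.

Lemma mx_equivalent_col0 (R : nzRingType) m1 m2 n (B C : 'M[R]_(m2, n)) :
  mx_equivalent B C ->
  mx_equivalent (col_mx (0 : 'M_(m1, n)) B) (col_mx 0 C).
Proof.
move=> [P [Q [iP iQ ->]]].
exists (block_mx 1%:M 0 0 P), Q; split=> //.
  exact: mx_invertible_diag (mx_invertible1 _ _) iP.
by rewrite mul_block_col !(mul0mx, mulmx0, addr0, add0r) mul_col_mx mul0mx.
Qed.

Lemma mx_equivalent_dsubmx (R : nzRingType) m1 m2 n (A : 'M[R]_(m1 + m2, n))
    (D : 'M_(m2, n)) :
  mx_equivalent (dsubmx A) D -> exists u, mx_equivalent A (col_mx u D).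
Proof.
move=> [P [Q [iP [Q' [QQ' Q'Q]] AE]]]; exists (usubmx A *m Q').
exists (block_mx 1%:M 0 0 P), Q; split.
- exact: mx_invertible_diag (mx_invertible1 _ _) iP.
- by exists Q'.
rewrite -[LHS]vsubmxK AE mul_block_col !(mul0mx, mulmx0, addr0, add0r).
by rewrite mul1mx mul_col_mx -(mulmxA _ Q') Q'Q mulmx1.
Qed.

(** * Two-sided ideals *)

Lemma ideal_sum (R : nzRingType) (J : set R) : two_sided_ideal J ->
  forall (I : Type) (s : seq I) (F : I -> R),
  (forall i, J (F i)) -> J (\sum_(i <- s) F i).
Proof.
move=> [J0 JB _ _] I s F JF; apply: (big_ind J) => // x y Jx Jy.
by rewrite -[y]opprK -[- y]sub0r; apply: (JB) => //; apply: JB.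
Qed.

Lemma principal_two_sided_self (R : nzRingType) (a : R) :
  principal_two_sided a a.
Proof. by exists [:: (1, 1)]; rewrite ?big_seq1 //= mul1r mulr1. Qed.

Lemma principal_two_sided_min (R : nzRingType) (J : set R) (a : R) :
  two_sided_ideal J -> J a -> principal_two_sided a `<=` J.
Proof.
move=> iJ Ja x [s _ <-]; apply: ideal_sum => // p.
by case: iJ => _ _ Jl Jr; apply/Jr/Jl.
Qed.

Lemma normal_ideal (R : nzRingType) (e : R) :
  principal_right e = principal_left e -> two_sided_ideal (principal_right e).
Proof.
move=> eE; split.
- by exists 0; rewrite ?mulr0.
- by move=> _ _ [r _ <-] [s _ <-]; exists (r - s); rewrite ?mulrBr.
- move=> r x; rewrite eE => -[s _ <-].
  by exists (r * s); rewrite ?mulrA.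
- by move=> r _ [s _ <-]; exists (s * r); rewrite ?mulrA.
Qed.

Lemma normal_duo (R : nzRingType) (e : R) :
  e <> 0 -> principal_right e = principal_left e -> duo e.
Proof.
by move=> e0 eE; split=> //; last rewrite -eE; apply: normal_ideal.
Qed.

Lemma ideal_mulmxl (R : nzRingType) (J : set R) m n p
    (P : 'M[R]_(m, n)) (A : 'M[R]_(n, p)) : two_sided_ideal J ->
  (forall i j, J (A i j)) -> forall i j, J ((P *m A) i j).
Proof.
move=> iJ JA i j; rewrite mxE; apply: ideal_sum => // k.
by case: iJ => _ _ Jl _; apply: Jl.
Qed.

Lemma ideal_mulmxr (R : nzRingType) (J : set R) m n p
    (A : 'M[R]_(m, n)) (Q : 'M[R]_(n, p)) : two_sided_ideal J ->
  (forall i j, J (A i j)) -> forall i j, J ((A *m Q) i j).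
Proof.
move=> iJ JA i j; rewrite mxE; apply: ideal_sum => // k.
by case: iJ => _ _ _ Jr; apply: Jr.
Qed.

Lemma ideal_equivalent (R : nzRingType) (J : set R) m n (A B : 'M[R]_(m, n)) :
  two_sided_ideal J -> mx_equivalent A B ->
  (forall i j, J (B i j)) -> forall i j, J (A i j).
Proof.
move=> iJ [P [Q [_ _ ->]]] JB.
by apply: ideal_mulmxr => //; apply: ideal_mulmxl.
Qed.

Lemma ideal_block_mx (R : nzRingType) (J : set R) m1 m2 n1 n2
    (A : 'M[R]_(m1, n1)) (B : 'M_(m1, n2)) (C : 'M_(m2, n1)) (D : 'M_(m2, n2)) :
  (forall i j, J (A i j)) -> (forall i j, J (B i j)) ->
  (forall i j, J (C i j)) -> (forall i j, J (D i j)) ->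
  forall i j, J (block_mx A B C D i j).
Proof.
move=> JA JB JC JD i j; rewrite -(splitK i) -(splitK j).
case: (split i) (split j) => [i'|i'] [j'|j'] /=.
- by rewrite block_mxEul.
- by rewrite block_mxEur.
- by rewrite block_mxEdl.
- by rewrite block_mxEdr.
Qed.

(** * Reduction of rows and columns over a Hermite ring *)

(** In the three regrouping lemmas below, the sizes [1 + (1 + n)] and [2 + n]
    are convertible, so no cast is needed; the one produced by the general
    associativity lemmas is along a reflexive equation. *)
Lemma row_mxA1 (R : nzRingType) m n (a b : 'cV[R]_m) (v : 'M_(m, n)) :
  row_mx a (row_mx b v) = row_mx (row_mx a b) v :> 'M_(m, 2 + n).
Proof. by rewrite row_mxA (eq_axiomK (esym _)) castmx_id. Qed.

Lemma col_mxA1 (R : nzRingType) m n (a b : 'rV[R]_n) (v : 'M_(m, n)) :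
  col_mx a (col_mx b v) = col_mx (col_mx a b) v :> 'M_(2 + m, n).
Proof. by rewrite col_mxA (eq_axiomK (esym _)) castmx_id. Qed.

Lemma block_mx_regroup (R : nzRingType) m n (a u b c : 'M[R]_1)
    (v w : 'rV[R]_n) (x y : 'cV[R]_m) (Z : 'M[R]_(m, n)) :
  block_mx (block_mx a u b c) (col_mx v w) (row_mx x y) Z
  = block_mx a (row_mx u v) (col_mx b x) (block_mx c w y Z)
    :> 'M[R]_(2 + m, 2 + n).
Proof.
by rewrite block_mxA !(eq_axiomK (esym _)) castmx_id.
Qed.

Lemma row2E (R : nzRingType) (a b : R) :
  row2 a b = row_mx (a%:M : 'M_1) (b%:M : 'M_1) :> 'rV_(1 + 1).
Proof.
apply/rowP => j; rewrite [LHS]mxE -(splitK j).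
by case: (split j) => k; rewrite ord1 /= ?row_mxEl ?row_mxEr mxE eqxx.
Qed.

Lemma row2_trE (R : nzRingType) (a b : R) :
  (row2 a b)^T = col_mx (a%:M : 'M_1) (b%:M : 'M_1) :> 'cV_(1 + 1).
Proof.
by rewrite row2E; apply: etrans (tr_row_mx _ _) _; rewrite !tr_scalar_mx.
Qed.

Lemma row_reduction (R : nzRingType) : hermite_ring R ->
  forall n (v : 'rV[R]_(1 + n)),
  exists (Q : 'M_(1 + n)) (d : R),
    mx_invertible Q /\ v *m Q = row_mx d%:M 0.
Proof.
move=> hH; elim=> [|n IHn] v.
  exists 1%:M, (v 0 0); split; first exact: mx_invertible1.
  rewrite mulmx1 -[LHS]hsubmxK; congr row_mx; last exact: thinmx0.
  by rewrite [LHS]mx11_scalar mxE lshift0.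
have [Q [d [iQ vQ]]] := IHn (@rsubmx _ 1 1 (1 + n) v).
pose a := (@lsubmx _ 1 1 (1 + n) v) 0 0.
have [P [_ [c [_ [iP _ abP _]]]]] := hH a d.
exists (block_mx (1%:M : 'M_1) 0 0 Q *m (block_mx P 0 0 1%:M : 'M_(2 + n))), c.
split; first exact: (@mx_invertibleM _ (2 + n) _ _
    (mx_invertible_diag (mx_invertible1 _ 1) iQ)
    (mx_invertible_diag iP (mx_invertible1 _ n))).
have vE : v *m block_mx (1%:M : 'M_1) 0 0 Q
          = row_mx (row2 a d) (0 : 'M_(1, n)) :> 'rV_(2 + n).
  rewrite -{1}[v](@hsubmxK _ 1 1 (1 + n)) mul_row_block.
  rewrite !(mul0mx, mulmx0, addr0, add0r) mulmx1 vQ.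
  by rewrite [lsubmx v]mx11_scalar -/a row_mxA1 -row2E.
have dE : row_mx (row2 a d) (0 : 'M_(1, n)) *m block_mx P 0 0 1%:M
          = row_mx c%:M (0 : 'M_(1, 1 + n)).
  rewrite mul_row_block !(mul0mx, mulmx0, addr0, add0r) abP row2E -row_mxA1.
  by rewrite raddf0 row_mx0.
exact: (etrans (mulmxA _ _ _) (etrans (congr1 (mulmx^~ _) vE) dE)).
Qed.

Lemma col_reduction (R : nzRingType) : hermite_ring R ->
  forall m (v : 'cV[R]_(1 + m)),
  exists (P : 'M_(1 + m)) (d : R),
    mx_invertible P /\ P *m v = col_mx d%:M 0.
Proof.
move=> hH; elim=> [|m IHm] v.
  exists 1%:M, (v 0 0); split; first exact: mx_invertible1.
  rewrite mul1mx -[LHS]vsubmxK; congr col_mx; last exact: flatmx0.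
  by rewrite [LHS]mx11_scalar mxE lshift0.
have [P [d [iP vP]]] := IHm (@dsubmx _ 1 (1 + m) 1 v).
pose a := (@usubmx _ 1 (1 + m) 1 v) 0 0.
have [_ [Q [_ [c [_ iQ _ abQ]]]]] := hH a d.
exists ((block_mx Q 0 0 1%:M : 'M_(2 + m)) *m block_mx (1%:M : 'M_1) 0 0 P), c.
split; first exact: (@mx_invertibleM _ (2 + m) _ _
    (mx_invertible_diag iQ (mx_invertible1 _ m))
    (mx_invertible_diag (mx_invertible1 _ 1) iP)).
have vE : block_mx (1%:M : 'M_1) 0 0 P *m v
          = col_mx (row2 a d)^T (0 : 'M_(m, 1)) :> 'cV_(2 + m).
  rewrite -{1}[v](@vsubmxK _ 1 (1 + m) 1) mul_block_col.
  rewrite !(mul0mx, mulmx0, addr0, add0r) mul1mx vP.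
  by rewrite [usubmx v]mx11_scalar -/a col_mxA1 -row2_trE.
have dE : block_mx Q 0 0 1%:M *m col_mx (row2 a d)^T (0 : 'M_(m, 1))
          = col_mx c%:M (0 : 'M_(1 + m, 1)).
  rewrite mul_block_col !(mul0mx, mulmx0, addr0, add0r) abQ row2_trE -col_mxA1.
  by rewrite raddf0 col_mx0.
exact: (etrans (esym (mulmxA _ _ _)) (etrans (congr1 (mulmx _) vE) dE)).
Qed.

(** * Normal forms *)

(** The divisibility chain and duo conditions on the diagonal entries that
    the EDK property imposes; nothing is required of the last entry. *)
Definition EDK_chain (R : nzRingType) (eps : seq R) : Prop :=
  forall i : nat, (i.+1 < size eps)%N ->
    principal_two_sided eps`_i.+1 `<=`
      principal_left eps`_i `&` principal_right eps`_i
    /\ duo eps`_i.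

(** [A] is equivalent to a matrix diag(eps_1, ..., eps_k, 0, ..., 0) as in the
    EDK property. *)
Definition has_EDK_form (R : nzRingType) m n (A : 'M[R]_(m, n)) : Prop :=
  exists eps : seq R,
    [/\ (size eps <= minn m n)%N,
        mx_equivalent A (rect_diag m n eps) & EDK_chain eps].

(** Every 2 x 2 matrix is equivalent to some diag(eps, a) with [eps] either
    zero or such that eps R = R eps and this ideal contains RaR. *)
Definition normal_2x2_reduction (R : nzRingType) : Prop :=
  forall A : 'M[R]_2, exists eps a : R,
    mx_equivalent A (rect_diag 2 2 [:: eps; a]) /\
    ((principal_two_sided a `<=` principal_right eps /\
      principal_right eps = principal_left eps) \/ eps = 0).

Lemma EDK_property_from_forms (R : nzRingType) :
  (forall m n (A : 'M[R]_(m, n)), has_EDK_form A) -> EDK_property R.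
Proof.
move=> H m n A; have [eps [leeps /mx_equivalent_sym[P [Q [iP iQ E]]] ch]] :=
  H m n A.
by exists P, Q, eps; split.
Qed.

Lemma has_EDK_form_equivalent (R : nzRingType) m n (A B : 'M[R]_(m, n)) :
  mx_equivalent A B -> has_EDK_form B -> has_EDK_form A.
Proof.
move=> AB [eps [le eB ch]]; exists eps; split=> //.
exact: mx_equivalent_trans eB.
Qed.

Lemma rect_diag_cons (R : nzRingType) m n (d : R) (eps : seq R) :
  rect_diag (1 + m) (1 + n) (d :: eps)
  = block_mx (d%:M : 'M_1) 0 0 (rect_diag m n eps).
Proof.
apply/matrixP=> i j; rewrite [LHS]mxE -(splitK i) -(splitK j).
case: (split i) (split j) => [i'|i'] [j'|j'] /=.
- by rewrite !ord1 block_mxEul mxE.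
- by rewrite !ord1 block_mxEur mxE.
- by rewrite !ord1 block_mxEdl mxE.
- by rewrite block_mxEdr mxE !add1n eqSS.
Qed.

Lemma rect_diag_nil (R : nzRingType) m n :
  rect_diag m n [::] = 0 :> 'M[R]_(m, n).
Proof. by apply/matrixP=> i j; rewrite !mxE nth_nil if_same. Qed.

Lemma has_EDK_form0 (R : nzRingType) m n : has_EDK_form (0 : 'M[R]_(m, n)).
Proof.
by exists [::]; split; rewrite ?rect_diag_nil //; apply: mx_equivalent_refl.
Qed.

Lemma has_EDK_form1 (R : nzRingType) m n (d : R) :
  has_EDK_form (block_mx (d%:M : 'M_1) 0 0 (0 : 'M_(m, n))).
Proof.
exists [:: d]; split=> //; first by rewrite /= leq_min.
by rewrite rect_diag_cons rect_diag_nil; apply: mx_equivalent_refl.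
Qed.

(** Indices beyond the size are covered as well, the default being 0. *)
Lemma EDK_chain_ideal (R : nzRingType) (eps : seq R) (J : set R) :
  EDK_chain eps -> two_sided_ideal J -> J eps`_0 -> forall i, J eps`_i.
Proof.
move=> ch iJ J0; elim=> // i IHi.
case: (ltnP i.+1 (size eps)) => [lti|/(nth_default 0) ->]; last by case: iJ.
have [/(_ _ (principal_two_sided_self _)) [[r _ <-] _] _] := ch i lti.
by case: iJ => _ _ Jl _; apply: Jl.
Qed.

(** The bound on the size of [eps] ensures that the added row, once at the
    bottom, is disjoint from the nonzero part of the diagonal. *)
Lemma has_EDK_form_row0 (R : nzRingType) m n (A : 'M[R]_(m, n)) :
  has_EDK_form A -> has_EDK_form (col_mx (0 : 'rV_n) A).
Proof.
move=> [eps [le eA ch]]; exists eps; split=> //.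
  by move: le; rewrite !leq_min => /andP[/leqW -> ->].
apply: mx_equivalent_trans (mx_equivalent_col0 1 eA) _.
(* [ordS] is the cyclic shift: row i is replaced by row i + 1, and the last
   row by row 0. *)
suff <- : row_perm (perm (@ordS_inj (1 + m))) (col_mx 0 (rect_diag m n eps))
   = rect_diag (1 + m) n eps by apply/mx_equivalent_sym/mx_equivalent_row_perm.
apply/matrixP=> i j; rewrite [LHS]mxE permE.
have [lti|gei] := ltnP i m.
  have -> : ordS i = rshift 1 (Ordinal lti).
    by apply: val_inj; rewrite /= modn_small.
  by rewrite col_mxEd !mxE.
have ei : i = m :> nat by apply/eqP; rewrite eqn_leq gei -ltnS ltn_ord.
have -> : ordS i = lshift m 0 by apply: val_inj; rewrite /= ei modnn.
rewrite col_mxEu !mxE ei; case: eqP => // _.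
by rewrite nth_default // (leq_trans le) // geq_minl.
Qed.

(** * The induction on the number of rows *)

(** The condition on [C] and [D] says that their entries lie in the two-sided
    ideal generated by the entries of [B]. *)
Lemma reduce_to_2x2_block (R : nzRingType) (hH : hermite_ring R) m n :
  (forall A : 'M[R]_(1 + m, 2 + n), has_EDK_form A) ->
  forall A : 'M[R]_(2 + m, 2 + n),
  exists (B : 'M_2) (C : 'M_(m, 2)) (D : 'M_(m, n)),
    mx_equivalent A (block_mx B 0 C D) /\
    forall J : set R, two_sided_ideal J -> (forall i j, J (B i j)) ->
      (forall i j, J (C i j)) /\ (forall i j, J (D i j)).
Proof.
move=> IH A.
(* Bringing the lower rows to normal form changes the top row to some u. *)
have [bs [_ /mx_equivalent_dsubmx[u uE] ch]] :=
  IH (@dsubmx _ 1 (1 + m) (2 + n) A).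
pose a := (@lsubmx _ 1 1 (1 + n) u) 0 0.
have [Q2 [c [iQ2 wE]]] := row_reduction hH (@rsubmx _ 1 1 (1 + n) u).
(* If bs is empty, then bs`_0 = 0 and D' = 0, so this case is not special. *)
pose D' : 'M[R]_(m, 1 + n) := rect_diag m (1 + n) (behead bs).
have bsE : rect_diag (1 + m) (1 + (1 + n)) bs
         = block_mx ((bs`_0)%:M : 'M_1) 0 0 D'.
  rewrite /D' -rect_diag_cons; case: (bs) => //=.
  by rewrite rect_diag_cons !rect_diag_nil raddf0 block_mx0.
pose y := lsubmx (D' *m Q2); pose Z := rsubmx (D' *m Q2).
exists (block_mx a%:M c%:M (bs`_0)%:M 0 : 'M_(1 + 1)).
exists (row_mx (0 : 'M_(m, 1)) y), Z.
split; last first.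
  move=> J iJ JB.
  have J0 : J 0 by case: iJ.
  have Jb : J bs`_0.
    have := JB (@rshift 1 1 0) (@lshift 1 1 0).
    by rewrite (@block_mxEdl _ 1 1 1 1) mxE eqxx mulr1n.
  have JD : forall i j, J ((D' *m Q2) i j).
    apply: ideal_mulmxr => // i j; rewrite mxE nth_behead.
    by case: eqP => // _; apply: EDK_chain_ideal ch iJ Jb _.
  split=> i j; last by rewrite mxE.
  rewrite -[j](@splitK 1 1); case: (@split 1 1 j) => k.
    by rewrite /= (@row_mxEl _ m 1 1) mxE.
  by rewrite /= (@row_mxEr _ m 1 1) mxE.
apply: (mx_equivalent_trans uE).
have uaE : u = row_mx a%:M (@rsubmx _ 1 1 (1 + n) u) :> 'rV_(1 + (1 + n)).
  by rewrite /a -mx11_scalar hsubmxK.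
rewrite bsE {1}uaE.
have A2 : col_mx (row_mx (a%:M : 'M_1) (@rsubmx _ 1 1 (1 + n) u))
                 (block_mx ((bs`_0)%:M : 'M_1) 0 0 D')
          *m block_mx (1%:M : 'M_1) 0 0 Q2
        = block_mx (block_mx a%:M c%:M (bs`_0)%:M 0 : 'M_(1 + 1)) 0
                   (row_mx (0 : 'M_(m, 1)) y) Z :> 'M_(2 + m, 2 + n).
  rewrite mul_col_mx mul_row_block mulmx_block.
  rewrite !(mul0mx, mulmx0, addr0, add0r) !mulmx1 wE.
  rewrite -(@col_mx0 _ 1 1 n) block_mx_regroup.
  have -> : block_mx (0 : 'M_1) (0 : 'rV_n) y Z = col_mx 0 (D' *m Q2).
    by rewrite /block_mx row_mx0 hsubmxK.
  by rewrite [in LHS]block_mxEh.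
rewrite -A2; apply: mx_equivalent_sym; apply: mx_equivalentMr.
exact: (@mx_invertible_diag _ 1 (1 + n) _ _ (mx_invertible1 _ 1) iQ2).
Qed.

Lemma has_EDK_form_step (R : nzRingType) (hH : hermite_ring R)
    (h2 : normal_2x2_reduction R) m n :
  (forall n (A : 'M[R]_(1 + m, n)), has_EDK_form A) ->
  forall A : 'M[R]_(2 + m, 2 + n), has_EDK_form A.
Proof.
move=> IH A.
have [B [C [D [AB hJ]]]] := reduce_to_2x2_block hH (@IH _) A.
apply: (has_EDK_form_equivalent AB).
have [e [a [[P [Q [iP [Q' [QQ' Q'Q]] BE]]] ha]]] := h2 B.
pose C' := C *m Q'.
have {AB} MM : mx_equivalent (block_mx B 0 C D)
    (block_mx (rect_diag 2 2 [:: e; a]) 0 C' D).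
  exists (block_mx P 0 0 1%:M), (block_mx Q 0 0 1%:M); split.
  - exact: mx_invertible_diag iP (mx_invertible1 _ _).
  - by apply: mx_invertible_diag (mx_invertible1 _ _); exists Q'.
  rewrite !mulmx_block !(mul0mx, mulmx0, addr0, add0r) !mul1mx !mulmx1 -BE.
  by rewrite /C' -mulmxA Q'Q mulmx1.
apply: (has_EDK_form_equivalent MM).
(* With e split off, x is the rest of the first column below the 2 x 2 block,
   and N is what remains after deleting the first row and column. *)
pose x := @lsubmx _ m 1 1 C'; pose y := @rsubmx _ m 1 1 C'.
pose N : 'M[R]_(1 + m, 1 + n) := block_mx (a%:M : 'M_1) 0 y D.
have -> : block_mx (rect_diag 2 2 [:: e; a]) 0 C' D
        = block_mx (e%:M : 'M_1) 0 (col_mx 0 x) N :> 'M_(2 + m, 2 + n).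
  have -> : rect_diag 2 2 [:: e; a] = block_mx e%:M 0 0 a%:M :> 'M_(1 + 1).
    rewrite (@rect_diag_cons _ 1 1); congr block_mx.
    by apply/matrixP=> i j; rewrite !ord1 !mxE.
  rewrite -[C'](@hsubmxK _ m 1 1) -(@col_mx0 _ 1 1 n) block_mx_regroup.
  by rewrite row_mx0.
have [e0|ne0] := pselect (e = 0).
  rewrite e0 raddf0 /block_mx row_mx0; apply: has_EDK_form_row0.
  exact: IH.
have [aJ eE] : principal_two_sided a `<=` principal_right e /\
  principal_right e = principal_left e by case: ha.
pose J := principal_right e; have iJ : two_sided_ideal J := normal_ideal eE.
have J0 : J 0 by case: iJ.
have Ja : J a by apply/aJ/principal_two_sided_self.
have Je : J e by exists 1; rewrite ?mulr1.
have JB : forall i j, J (B i j).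
  rewrite BE; apply: ideal_mulmxr => //; apply: ideal_mulmxl => // i j.
  rewrite mxE; case: eqP => // _.
  by case: (val i) => [|[|k]] //=; rewrite nth_nil.
have [JC JD] := hJ J iJ JB.
have JC' : forall i j, J (C' i j) by apply: ideal_mulmxr.
have JN : forall i j, J (N i j).
  apply: ideal_block_mx => // i j; rewrite mxE //.
  by case: eqP.
(* As J is also Re, the first column is X e; this is where left multiples of e
   are used. *)
have exf : forall i : 'I_(1 + m), exists r, r * e = col_mx 0 x i 0.
  move=> i; suff : J (col_mx 0 x i 0) by rewrite /J eE => -[r _ <-]; exists r.
  rewrite -(splitK i); case: (split i) => k /=.
    by rewrite col_mxEu mxE.
  by rewrite col_mxEd mxE.
have [f fE] := choice exf.
pose X : 'cV[R]_(1 + m) := \col_i f i.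
have XE : col_mx 0 x = X *m e%:M.
  by apply/colP=> i; rewrite -fE [RHS]mxE big_ord1 !mxE eqxx mulr1n.
have [eps [le NE ch]] := IH _ N.
have EE : block_mx (e%:M : 'M_1) 0 (col_mx 0 x) N
        = block_mx (1%:M : 'M_1) 0 X 1%:M *m block_mx (e%:M : 'M_1) 0 0 N.
  by rewrite mulmx_block !(mul0mx, mulmx0, addr0, add0r) !mul1mx XE.
rewrite EE; apply: (has_EDK_form_equivalent (@mx_equivalentMl
  _ (1 + (1 + m)) (1 + (1 + n)) _ _ (mx_invertible_lower X))).
exists (e :: eps); split.
- by rewrite /= !add1n minnSS ltnS.
- by rewrite (rect_diag_cons (1 + m) (1 + n)); apply: mx_equivalent_block_diag.
(* The entries of the normal form of N stay in J; if eps is empty, then its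
   default entry is 0. *)
have Jeps : J eps`_0.
  have [lt0|/(nth_default 0) -> //] := ltnP 0 (size eps).
  have := ideal_equivalent iJ (mx_equivalent_sym NE) JN 0 0.
  by rewrite mxE.
case=> [|i] lti /=; last exact: ch.
split; last exact: normal_duo.
by rewrite -eE setIid; apply: principal_two_sided_min.
Qed.

Lemma has_EDK_form_all (R : nzRingType) (hH : hermite_ring R)
    (h2 : normal_2x2_reduction R) m n
    (A : 'M[R]_(m, n)) : has_EDK_form A.
Proof.
elim: m n A => [|m IHm] [|n] A;
  rewrite ?(flatmx0 A) ?(thinmx0 A); try exact: has_EDK_form0.
case: m IHm A => [_|m IHm] A.
  have [Q [d [iQ AE]]] := row_reduction hH A.
  apply: (has_EDK_form_equivalent (mx_equivalent_sym (mx_equivalentMr A iQ))).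
  rewrite AE; suff -> : row_mx d%:M 0
      = block_mx (d%:M : 'M_1) 0 0 (0 : 'M_(0, n)) by apply: has_EDK_form1.
  apply/matrixP=> i j.
  have -> : i = @lshift 1 0 0 by rewrite ord1; apply: val_inj.
  by rewrite (@col_mxEu _ 1 0 (1 + n)); congr (row_mx _ _ _ _); apply: val_inj.
case: n A => [|n] A; last exact: has_EDK_form_step.
have [P [d [iP AE]]] := col_reduction hH A.
apply: (has_EDK_form_equivalent (mx_equivalent_sym (mx_equivalentMl A iP))).
rewrite AE; suff -> : col_mx d%:M 0
    = block_mx (d%:M : 'M_1) 0 0 (0 : 'M_(1 + m, 0)) by apply: has_EDK_form1.
apply/matrixP=> i j.
have -> : j = @lshift 1 0 0 by rewrite ord1; apply: val_inj.
rewrite block_mxEh (@row_mxEl _ (1 + (1 + m)) 1 0).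
by congr (col_mx _ _ _ _); apply: val_inj.
Qed.

Theorem theorem2p4 (R : nzRingType) (hH : hermite_ring R) (hD : D_property R) :
  EDK_property R <->
  (forall A : 'M[R]_2, exists eps a : R,
     mx_equivalent A (rect_diag 2 2 [:: eps; a]) /\
     ((principal_two_sided a `<=` principal_right eps /\
       principal_right eps = principal_left eps) \/ eps = 0)).
Proof.
split=> [hE A|h2]; last first.
  by apply: EDK_property_from_forms => m n A; apply: has_EDK_form_all.
have [P [Q [eps [iP iQ leeps AE ch]]]] := hE 2%N 2%N A.
have {AE} : mx_equivalent A (rect_diag 2 2 eps).
  by apply: mx_equivalent_sym; exists P, Q; split.
case: eps leeps ch => [|e [|a [|? ?]]] // _ ch AE.
- exists 0, 0; split; last by right.
  apply: mx_equivalent_trans AE _.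
  rewrite rect_diag_nil; suff -> : rect_diag 2 2 [:: 0; 0 : R] = 0.
    exact: mx_equivalent_refl.
  by rewrite !(@rect_diag_cons _ _ _) rect_diag_nil raddf0 !block_mx0.
- exists 0, e; split; last by right.
  apply: mx_equivalent_trans AE _.
  (* The cyclic shift of two indices swaps them. *)
  have <- : row_perm (perm (@ordS_inj 2)) (col_perm (perm (@ordS_inj 2))
              (rect_diag 2 2 [:: e])) = rect_diag 2 2 [:: 0; e].
    apply/matrixP=> -[[|[|i]] lti] [[|[|j]] ltj] //;
      by rewrite !mxE !permE.
  apply/mx_equivalent_sym/(mx_equivalent_trans (mx_equivalent_row_perm _ _)).
  exact: mx_equivalent_col_perm.
- exists e, a; split=> //; left.
  have [sub [_ _ _ eE]] := ch 0 isT; split=> // x /sub[].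
  by rewrite eE.
Qed.
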